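(* Let $X$ be a separable real Banach space with $\dim X \geq 2$ and let $f: X\to \mathbb{R}$ be a linearly continuous function having the Baire property. Then the set $D(f)$ of all discontinuity points of $f$ can be written as $D(f)= \bigcup_{k=1}^{\infty} B_k$, where each $B_k$ has the following properties: (i) $B_k$ is a bounded closed subset of a Lipschitz hypersurface $L_k \subset X$, and $B_k$ is nowhere dense in $L_k$; (ii) any linear projection of $B_k$ onto any hyperplane $H\subset X$ with $0\in H$ is a first category subset of $H$; (iii) for each $c \in X \setminus B_k$, the set $\left\{\frac{x-c}{\|x-c\|}:\ x \in B_k\right\}$ is a first category set in $S_X$.
   Context: A function $f:X\to\mathbb{R}$ is linearly continuous if its restriction to every (affine) line in $X$ is continuous. The system of sets with the Baire property in a metric space is the smallest $\sigma$-algebra containing all open sets and all first category (meager) sets; a function $f:X\to\mathbb{R}$ has the Baire property if $f^{-1}(B)$ has the Baire property for every Borel set $B\subset\mathbb{R}$. A set $A\subset X$ is a Lipschitz hypersurface if there exist a $1$-dimensional linear space $V\subset X$, a topological complement $Y$ of $V$ in $X$ (a closed linear subspace $Y$ with $X=V\oplus Y$), and a Lipschitz mapping $\varphi:Y\to V$ such that $A=\{y+\varphi(y): y\in Y\}$. A hyperplane $H\subset X$ with $0\in H$ is a linear subspace of $X$ of codimension $1$. A linear projection onto such an $H$ is a linear map $\pi:X\to H$ with $\pi(h)=h$ for all $h\in H$, and the corresponding projection of $B_k$ is the set $\pi(B_k)$. $S_X=\{x\in X:\|x\|=1\}$. ''First category in $H$'' (resp. in $S_X$) and ''nowhere dense in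 $L_k$'' are meant with respect to the subspace topology. *)

(* Defs.v *)
From HB Require Import structures.
From mathcomp Require Import all_boot all_order all_algebra.
From mathcomp Require Import all_classical all_reals all_analysis.

Set Implicit Arguments.
Unset Strict Implicit.
Unset Printing Implicit Defensive.

Import Order.TTheory GRing.Theory Num.Theory.
Import numFieldNormedType.Exports.

Local Open Scope classical_set_scope.
Local Open Scope ring_scope.

Definition separable (T : topologicalType) : Prop :=
  exists2 S : set T, countable S & dense S.

Definition nowhere_dense (T : topologicalType) (A : set T) : Prop :=
  (closure A)° = set0.

Definition meager (T : topologicalType) (A : set T) : Prop :=
  exists2 F : nat -> set T,
    (forall n, nowhere_dense (F n)) & A = \bigcup_n F n.

(* [subspace S] carries the relative topology on [S]; the points outside [S]
   are isolated, so both predicates below force [A `<=` S]. *)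
Definition nowhere_dense_in (T : topologicalType) (S A : set T) : Prop :=
  nowhere_dense (A : set (subspace S)).

Definition meager_in (T : topologicalType) (S A : set T) : Prop :=
  meager (A : set (subspace S)).

Definition baire_sets (T : topologicalType) : set (set T) :=
  <<s [set A : set T | open A \/ meager A] >>.

(* [measurable] on [R] is the Borel sigma-algebra. *)
Definition has_baire_property (R : realType) (T : topologicalType)
    (f : T -> R) : Prop :=
  forall B : set R, measurable B -> baire_sets (f @^-1` B).

Section Linear.
Context (R : realType) (X : normedModType R).
Implicit Types (A H L V Y : set X) (f : X -> R).

Definition affine_line (a u : X) : set X := [set a + t *: u | t in [set: R]].

Definition linearly_continuous f : Prop :=
  forall a u : X, u != 0 -> {within affine_line a u, continuous f}.

Definition discontinuities f : set X := [set x | ~ {for x, continuous f}].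

Definition dim_ge2 : Prop :=
  exists x y : X, forall a b : R, a *: x + b *: y = 0 -> a = 0 /\ b = 0.

Definition linear_subspace V : Prop := submod_closed (mem V).

Definition one_dimensional V : Prop :=
  exists2 v : X, v != 0 & V = [set t *: v | t in [set: R]].

(* Algebraic direct sum: [X = V (+) Y]. *)
Definition direct_sum V Y : Prop :=
  V `&` Y = [set 0] /\
  forall x, exists2 v, V v & exists2 y, Y y & x = v + y.

Definition lipschitz_hypersurface L : Prop :=
  exists V Y (phi : X -> X),
    [/\ one_dimensional V,
        [/\ linear_subspace Y, closed Y & direct_sum V Y],
        (forall y, Y y -> V (phi y)),
        [lipschitz phi y | y in Y] &
        L = [set y + phi y | y in Y]].

(* A linear subspace of codimension 1; it is not required to be closed. *)
Definition hyperplane0 H : Prop :=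
  linear_subspace H /\ exists2 V, one_dimensional V & direct_sum V H.

(* No continuity is required of [p]. *)
Definition linear_projection_onto H (p : {linear X -> X}) : Prop :=
  (forall x, H (p x)) /\ (forall h, H h -> p h = h).

Definition unit_sphere : set X := [set x | `|x| = 1].

Definition radial_projection (c x : X) : X := `|x - c|^-1 *: (x - c).

End Linear.
Arguments dim_ge2 {R} X.
Arguments unit_sphere {R} X.

(* Main.v *)
Require Import Defs.
From HB Require Import structures.
From mathcomp Require Import all_boot all_order all_algebra.
From mathcomp Require Import all_classical all_reals all_analysis.
From mathcomp Require Import ring lra.

Set Implicit Arguments.
Unset Strict Implicit.
Unset Printing Implicit Defensive.

Import Order.TTheory GRing.Theory Num.Theory.
Import numFieldNormedType.Exports.

Local Open Scope classical_set_scope.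
Local Open Scope ring_scope.

(** Call [x] a point of oscillation [> e] when every ball around it contains two
    points whose values differ by more than [e].  If an affine pencil
    [Phi t u = (w0 + t w1) + (l0 + t l1) u] is given, the functions
    [t |-> f (Phi t u)] are continuous on [[0, 1]], so countably many step
    functions approximate all of them; by Baire's theorem one step function
    works for residually many [u] in some open set.  A linearly continuous
    function bounded by [e] on a residual subset of an open set is bounded by
    [e] on all of it, so the step function works for every [u] in that set.

    For the pencil [x + t u] this gives an open cone with vertex [x] on which
    [f] oscillates by at most [2 e]; such a cone contains no point of oscillation
    [> 3 e].  Fixing the cone among countably many leaves closed sets free of
    pairs of points joined by cone directions: pieces of Lipschitz graphs.  For
    the pencils [z + t v] and [c + t u] it shows that an open set of parallel
    lines, or of rays from [c], misses the points of oscillation [> 3 e]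
    altogether, whence the three smallness properties. *)

(** * Sublinear functionals and the Hahn-Banach theorem *)

(** Domination by the norm is built in: it keeps infima along chains finite and bounds the linear
    functional found at the end. *)
Definition sublinear (R : realType) (X : normedModType R) (q : X -> R) : Prop :=
  [/\ forall x y, q (x + y) <= q x + q y,
      forall (t : R) x, 0 < t -> q (t *: x) <= t * q x &
      forall x, q x <= `|x|].

Section Sublinear.
Context {R : realType} {X : normedModType R}.
Implicit Types (q : X -> R) (x y : X).

Lemma sublinear_scale {q} : sublinear q ->
  forall (t : R) x, 0 <= t -> q (t *: x) = t * q x.
Proof.
move=> [_ qZ _] t x; rewrite le_eqVlt => /predU1P[<-|t0].
  (* The factors 2 and 1/2 give [q 0 >= 0] and [q 0 <= 0]. *)
  rewrite scale0r mul0r; have := qZ 2 0 (ltr0n _ 2).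
  by have := qZ 2^-1 0 ltac:(by rewrite invr_gt0); rewrite !scaler0; lra.
apply/eqP; rewrite eq_le qZ//=.
have := qZ t^-1 (t *: x) ltac:(by rewrite invr_gt0).
by rewrite scalerA mulVf ?gt_eqF// scale1r ler_pdivlMl.
Qed.

Lemma sublinear_ge {q} : sublinear q -> forall x y, q x - q (- y) <= q (x + y).
Proof. by move=> [qD _ _] x y; rewrite lerBlDr (le_trans _ (qD _ _))// addrK. Qed.

Lemma norm_sublinear : sublinear (fun x : X => `|x|).
Proof.
by split=> [x y|t x t0|x]; rewrite ?ler_normD// normrZ gtr0_norm.
Qed.

(* Shifting [q] along [y]: the largest sublinear minorant of [q] whose value
   at [- y] is [- q y]. *)
Let shift_set q y x := [set q (x + t *: y) - t * q y | t in [set t : R | 0 <= t]].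
Let shift q y x := inf (shift_set q y x).

Let shift_lb {q} y x : sublinear q -> has_lbound (shift_set q y x).
Proof.
move=> qS; exists (- q (- x)) => _ [t /= t0 <-].
have := sublinear_ge qS (t *: y) x.
by rewrite (sublinear_scale qS)// [x + _]addrC; lra.
Qed.

Let shift_le {q} y x (t : R) : sublinear q -> 0 <= t ->
  shift q y x <= q (x + t *: y) - t * q y.
Proof. by move=> qS t0; apply: ge_inf; [exact: shift_lb|exists t]. Qed.

Let shift_ge {q} y x (m : R) :
  (forall t : R, 0 <= t -> m <= q (x + t *: y) - t * q y) -> m <= shift q y x.
Proof.
move=> H; apply: lb_le_inf => [|_ [t /= t0 <-]]; last exact: H.
by eexists; exists 0 => /=.
Qed.

(** The last bound has two uses. For a minimal [q] it yields [q x + q y <= q (x + y)], hence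
    additivity; for the norm, at [x = - y], it yields the value [- |y|] needed for a norming
    functional. *)
Lemma sublinear_shift q y : sublinear q ->
  exists q', [/\ sublinear q', forall x, q' x <= q x &
    forall x, q' x <= q (x + y) - q y].
Proof.
move=> qS; have [qD qZ qn] := qS.
have le_q x : shift q y x <= q x.
  by have := shift_le y x qS (lexx 0); rewrite scale0r addr0 mul0r subr0.
exists (shift q y); split=> // [|x]; last first.
  by have := shift_le y x qS ler01; rewrite scale1r mul1r.
split=> [x x'|t x t0|x]; last exact: le_trans (le_q x) (qn x).
- rewrite -lerBlDr; apply: shift_ge => t t0.
  rewrite lerBlDr -lerBlDl; apply: shift_ge => s s0.
  rewrite lerBlDl (le_trans (shift_le y (x + x') qS (addr_ge0 t0 s0)))//.
  have -> : x + x' + (t + s) *: y = (x + t *: y) + (x' + s *: y).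
    by rewrite scalerDl addrACA.
by have := qD (x + t *: y) (x' + s *: y); lra.
- rewrite -ler_pdivrMl//; apply: shift_ge => s s0; rewrite ler_pdivrMl//.
  rewrite (le_trans (shift_le y (t *: x) qS (mulr_ge0 (ltW t0) s0)))//.
  have -> : t *: x + (t * s) *: y = t *: (x + s *: y) by rewrite scalerDr scalerA.
  by rewrite (sublinear_scale qS _ (ltW t0)) mulrBr mulrA.
Qed.

(* A chain of sublinear functionals is bounded below by its pointwise infimum. *)
Lemma minimal_sublinear q0 : sublinear q0 -> exists q, [/\ sublinear q,
  forall x, q x <= q0 x &
  forall q', sublinear q' -> (forall x, q' x <= q x) -> q' = q].
Proof.
move=> q0S.
pose T := {q : X -> R | sublinear q /\ forall x, q x <= q0 x}.
(* The order is reversed, so that Zorn's maximal element is a minimal functional. *)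
pose leT (s t : T) := `[< forall x, sval t x <= sval s x >].
have [] := @Zorn T leT.
- by move=> s; apply/asboolP.
- move=> r s t /asboolP rs /asboolP st; apply/asboolP => x.
  exact: le_trans (st x) (rs x).
- move=> [s Ps] [t Pt] /asboolP/= st /asboolP/= ts; apply: eq_exist.
  by apply/funext => x; apply/eqP; rewrite eq_le st ts.
(* The empty chain is bounded by [q0], an infimum over it being meaningless. *)
- move=> A Atot; have [[a Aa]|A0] := pselect (exists a, A a); last first.
    by exists (exist _ q0 (conj q0S (fun x => lexx _))) => s As; case: A0; exists s.
  pose S x := [set sval s x | s in A].
  have Slb x : has_lbound (S x).
    exists (- `|x|) => _ [[s [sS sq0]] _ <-] /=; have [_ _ sn] := sS.
    have := sublinear_ge sS 0 x; have := sn (- x); rewrite normrN add0r.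
    have := sublinear_scale sS 0 (lexx 0); rewrite scale0r mul0r; lra.
  have infS x s : A s -> inf (S x) <= sval s x.
    by move=> As; apply: ge_inf; [exact: Slb|exists s].
  have Sinf x (m : R) : (forall s, A s -> m <= sval s x) -> m <= inf (S x).
    move=> H; apply: lb_le_inf => [|_ [s As <-]]; last exact: H.
    by exists (sval a x); exists a.
  have iS : sublinear (fun x => inf (S x)) /\ forall x, inf (S x) <= q0 x.
    split; last by move=> x; apply: le_trans (infS x a Aa) _; apply: (svalP a).2.
    split=> [x y|t x t0|x].
    + rewrite -lerBlDr; apply: (Sinf x) => s As.
      rewrite lerBlDr -lerBlDl; apply: (Sinf y) => t At; rewrite lerBlDl.
      have [sD _ _] := (svalP s).1; have [tD _ _] := (svalP t).1.
      (* Of two members of the chain, the smaller one serves for both [x] and [y]. *)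
      have [/asboolP st|/asboolP ts] := Atot _ _ As At.
      * by have := infS (x + y) _ At; have := tD x y; have := st x; lra.
      * by have := infS (x + y) _ As; have := sD x y; have := ts y; lra.
    + rewrite -ler_pdivrMl//; apply: Sinf => s As; rewrite ler_pdivrMl//.
      apply: le_trans (infS _ _ As) _.
      by rewrite (sublinear_scale (svalP s).1 _ (ltW t0)).
    + by apply: le_trans (infS x a Aa) _; have [_ _] := (svalP a).1; apply.
  pose i : T := exist _ (fun x => inf (S x)) iS.
  by exists i => s As; apply/asboolP => x /=; exact: infS.
- move=> [q [qS qq0]] qmin; exists q; split=> // q' q'S q'q.
  have q'q0 x : q' x <= q0 x by exact: le_trans (q'q x) (qq0 x).
  exact: (congr1 sval (qmin (exist _ q' (conj q'S q'q0)) (asboolT q'q))).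
Qed.

(** A minimal sublinear functional is additive, since shifting it along any [y] cannot lower it.
    Minimising below the norm shifted along [u] forces the value [- |u|] at [- u]. *)
Lemma norming_functional (u : X) :
  exists2 g : X -> R, (forall (t : R) x y, g (t *: x + y) = t * g x + g y) &
    (forall x, `|g x| <= `|x|) /\ g u = `|u|.
Proof.
have [q1 [q1S q1n q1u]] := sublinear_shift u norm_sublinear.
have [q [qS qq1 qmin]] := minimal_sublinear q1S.
have [qD qZ qn] := qS.
have qDE x y : q (x + y) = q x + q y.
  apply/eqP; rewrite eq_le qD/=.
  have [q2 [q2S q2q q2y]] := sublinear_shift y qS.
  by have := q2y x; rewrite (qmin _ q2S q2q); lra.
have q0 : q 0 = 0 by have := qDE 0 0; rewrite addr0; lra.
have qN x : q (- x) = - q x by have := qDE x (- x); rewrite subrr q0; lra.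
have qZE (t : R) x : q (t *: x) = t * q x.
  have [t0|t0] := leP 0 t; first exact: sublinear_scale.
  by rewrite -[t]opprK scaleNr qN sublinear_scale ?mulNr// oppr_ge0 ltW.
exists q => [t x y|]; first by rewrite qDE qZE.
split=> [x|]; first by rewrite ler_norml qn andbT lerNl -qN -normrN qn.
apply/eqP; rewrite eq_le qn/=.
by have := q1u (- u); have := qq1 (- u); rewrite qN addNr normr0; lra.
Qed.
End Sublinear.

(** * Baire category and sets that are open modulo meager sets *)

Section Category.
Context {T : topologicalType}.
Implicit Types (A B U W : set T).

Lemma nowhere_denseP A : nowhere_dense A <->
  forall U, open U -> U !=set0 ->
    exists W, [/\ open W, W !=set0, W `<=` U & W `&` A = set0].
Proof.
split=> [nA U oU U0|nA].
  exists (U `\` closure A); split.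
  - by rewrite setDE; apply: openI => //; exact/closed_openC/closed_closure.
  - apply/set0P/eqP; rewrite setD_eq0 => UA; case: U0 => x.
    by rewrite open_subsetE// in UA; move=> /UA; rewrite nA.
  - by move=> x [].
  - by rewrite -subset0 => x [[_ +] /subset_closure]; apply.
rewrite /nowhere_dense -subset0 => x /= xA.
have [||W [oW [y Wy] WA WA0]] := nA (closure A)°; first exact: open_interior.
  by exists x.
have /(_ W) := interior_subset (WA _ Wy).
by rewrite setIC WA0 => -[|//]; exact: open_nbhs_nbhs.
Qed.

Lemma nowhere_denseS A B : A `<=` B -> nowhere_dense B -> nowhere_dense A.
Proof.
move=> AB /nowhere_denseP nB; apply/nowhere_denseP => U oU U0.
have [W [oW W0 WU WB]] := nB U oU U0; exists W; split=> //.
by rewrite -subset0 -WB; exact: setIS.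
Qed.

Lemma nowhere_dense0 : nowhere_dense (@set0 T).
Proof. by rewrite /nowhere_dense closure0 interior0. Qed.

Lemma meagerS A B : A `<=` B -> meager B -> meager A.
Proof.
move=> AB [F nF BF]; exists (fun n => F n `&` A).
  by move=> n; apply: nowhere_denseS (nF n) => x [].
by rewrite -setI_bigcupl -BF setIC setIidl.
Qed.

Lemma nowhere_dense_meager A : nowhere_dense A -> meager A.
Proof. by move=> nA; exists (fun=> A) => //; rewrite bigcup_const. Qed.

Lemma meager_bigcup (I : countType) (A : I -> set T) :
  (forall i, meager (A i)) -> meager (\bigcup_i A i).
Proof.
move=> mA; pose F i := sval (cid2 (mA i)).
have nF i k : nowhere_dense (F i k) by rewrite /F; case: cid2.
have AF i : A i = \bigcup_k F i k by rewrite /F; case: cid2.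
pose G m := if @unpickle (I * nat)%type m is Some p then F p.1 p.2 else set0.
exists G.
  by move=> m; rewrite /G; case: unpickle => [p|]; [exact: nF|exact: nowhere_dense0].
apply/seteqP; split=> [x [i _]|x [m _]].
  rewrite AF => -[k _ Fx]; exists (pickle (i, k)) => //.
  by rewrite /G pickleK.
by rewrite /G; case: unpickle => [p Fx|//]; exists p.1 => //; rewrite AF; exists p.2.
Qed.

Lemma meagerU A B : meager A -> meager B -> meager (A `|` B).
Proof.
move=> mA mB; rewrite -bigcup2E.
by apply: meager_bigcup => -[|[|n]] //=; exact: nowhere_dense_meager nowhere_dense0.
Qed.

(** The explicit form of the Baire property. Unlike membership in a generated sigma-algebra, it
    hands over an open set to work in. *)
Definition almost_open A :=
  exists O, [/\ open O, meager (A `\` O) & meager (O `\` A)].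

Lemma open_almost_open A : open A -> almost_open A.
Proof.
by exists A; rewrite setDv; split=> //; exact: nowhere_dense_meager nowhere_dense0.
Qed.

Lemma meager_almost_open A : meager A -> almost_open A.
Proof.
exists set0; rewrite setD0 set0D; split=> //; first exact: open0.
exact: nowhere_dense_meager nowhere_dense0.
Qed.

(** The complement of an open set differs from its own interior by a boundary, which is nowhere
    dense. *)
Lemma almost_openC A : almost_open A -> almost_open (~` A).
Proof.
move=> [V [oV AO OA]]; exists (~` V)°; split; first exact: open_interior.
  apply: (@meagerS _ (V `\` A `|` (~` V `\` (~` V)°))).
    by move=> x [nA nO]; have [Vx|Vx] := pselect (V x); [left|right].
  apply: meagerU => //; apply: nowhere_dense_meager; apply/nowhere_denseP => U oU U0.
  have [[x [Ux Vx]]|UO] := pselect (U `&` V !=set0).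
    exists (U `&` V); split; [exact: openI|by exists x|by move=> y []|].
    by rewrite -subset0 => y [[_ Vy] [/(_ Vy)]].
  exists U; split=> //; rewrite -subset0 => x [Ux [_]]; apply.
  apply: (filterS _ (open_nbhs_nbhs (conj oU Ux))) => y Uy Vy.
  by apply: UO; exists y.
apply: meagerS AO => x [/interior_subset/= Vx nnA]; split=> //.
exact: contrapT nnA.
Qed.

Lemma almost_open_bigcup (I : countType) (A : I -> set T) :
  (forall i, almost_open (A i)) -> almost_open (\bigcup_i A i).
Proof.
move=> /choice[V AO].
exists (\bigcup_i V i); split.
- by apply: bigcup_open => i _; have [] := AO i.
- apply: (@meagerS _ (\bigcup_i (A i `\` V i))).
    by move=> x [[i _ Ai] nO]; exists i => //; split=> // Oi; apply: nO; exists i.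
  by apply: meager_bigcup => i; have [] := AO i.
- apply: (@meagerS _ (\bigcup_i (V i `\` A i))).
    by move=> x [[i _ Oi] nA]; exists i => //; split=> // Ai; apply: nA; exists i.
  by apply: meager_bigcup => i; have [] := AO i.
Qed.

Lemma almost_open_bigcap (I : countType) (A : I -> set T) :
  (forall i, almost_open (A i)) -> almost_open (\bigcap_i A i).
Proof.
move=> AO; rewrite -[X in almost_open X]setCK setC_bigcap.
by apply: almost_openC; apply: almost_open_bigcup => i; exact: almost_openC.
Qed.

Lemma baire_sets_almost_open A : baire_sets A -> almost_open A.
Proof.
move: A; apply: smallest_sub => [|A [|]]; last 2 first.
- exact: open_almost_open.
- exact: meager_almost_open.
split=> [|A AO|A AO].
- exact: meager_almost_open (nowhere_dense_meager nowhere_dense0).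
- by rewrite setTD; exact: almost_openC.
- exact: almost_open_bigcup.
Qed.

End Category.

Section CategoryPreimage.
Context {S T : topologicalType} (phi : S -> T).
Hypotheses (phi_cont : continuous phi)
  (phi_open : forall U, open U -> open (phi @` U)).

(** Openness of [phi] carries a test set to the target, where nowhere density provides a hole;
    continuity pulls the hole back. *)
Lemma meager_preimage A : meager A -> meager (phi @^-1` A).
Proof.
move=> [F nF ->]; exists (fun n => phi @^-1` F n); last by rewrite preimage_bigcup.
move=> n; apply/nowhere_denseP => U oU [x Ux].
have [] := (nowhere_denseP _).1 (nF n) (phi @` U) (phi_open oU).
  by exists (phi x); exists x.
move=> W [oW [y Wy] WU WF]; have [z Uz zy] := WU _ Wy.
exists (U `&` phi @^-1` W); split.
- by apply: openI => //; apply: open_comp => // ? _; exact: phi_cont.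
- by exists z; split=> //=; rewrite zy.
- by move=> ? [].
- by rewrite -subset0 => w [[_ Ww] Fw]; suff: (W `&` F n) (phi w) by rewrite WF.
Qed.

Lemma almost_open_preimage A : almost_open A -> almost_open (phi @^-1` A).
Proof.
move=> [V [oV AO OA]]; exists (phi @^-1` V); split; last 2 first.
- exact: meager_preimage AO.
- exact: meager_preimage OA.
- by apply: open_comp => // ? _; exact: phi_cont.
Qed.

End CategoryPreimage.

Section BaireCategory.
Context {R : realType} {X : completeNormedModType R}.
Implicit Types (U : set X).

Lemma open_nonmeager U : open U -> U !=set0 -> ~ meager U.
Proof.
move=> oU U0 [F nF UF].
have [|x [Ux Fx]] := @Baire _ X (fun n => ~` closure (F n)) _ U U0 oU.
  move=> n; split; first exact/closed_openC/closed_closure.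
  move=> V V0 oV; have [W [oW [y Wy] WV WF]] := (nowhere_denseP _).1 (nF n) V oV V0.
  exists y; split; first exact: WV.
  move=> /(_ W (open_nbhs_nbhs (conj oW Wy))).
  by rewrite setIC WF => -[].
by move: Ux; rewrite UF => -[n _ /subset_closure]; exact: Fx.
Qed.

(** If no [E i] were residual in an open part of [U], the open sets [V i] would all miss [U] on
    [E i], and the meager sets [E i \ V i] would cover [U]. *)
Lemma almost_open_cover (I : countType) (E : I -> set X) U :
    open U -> U !=set0 -> (forall i, almost_open (E i)) ->
    (forall x, U x -> exists i, E i x) ->
  exists i W, [/\ open W, W !=set0, W `<=` U & meager (W `\` E i)].
Proof.
move=> oU U0 /choice[V EO] UE; apply: contrapT => noW.
apply: (open_nonmeager oU U0).
apply: (@meagerS _ _ (\bigcup_i (E i `\` V i))); last first.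
  by apply: meager_bigcup => i; have [] := EO i.
move=> x Ux; have [i Eix] := UE x Ux; exists i => //; split=> // Ox.
have [oO _ OE] := EO i.
apply: noW; exists i, (U `&` V i); split; [exact: openI|by exists x|by move=> ? []|].
by apply: meagerS OE => y [[_ Oy] nE].
Qed.

End BaireCategory.

(** * Affine maps and continuity along lines *)

Section AffineMaps.
Context {R : realType} {X : normedModType R}.

Lemma open_norm_ball (U : set X) x : open U -> U x ->
  exists2 r : R, 0 < r & forall y, `|y - x| < r -> U y.
Proof.
move=> oU Ux; have /nbhs_ballP[r r0 rU] := open_nbhs_nbhs (conj oU Ux).
by exists r => // y yx; apply: rU; rewrite -ball_normE /= distrC.
Qed.

Lemma norm_ballP (x y : X) (r : R) : ball x r y = (`|y - x| < r) :> Prop.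
Proof. by rewrite -ball_normE /= distrC. Qed.

Lemma open_nonzero : open [set x : X | x != 0].
Proof.
rewrite (_ : [set x | _] = ~` [set 0]); last first.
  by apply/seteqP; split=> x /eqP.
exact/closed_openC/accessible_closed_set1/hausdorff_accessible/norm_hausdorff.
Qed.

Lemma affine_continuous (w : X) (l : R) : continuous (fun u => w + l *: u).
Proof. by move=> u; apply: cvgD; [exact: cvg_cst|apply: cvgZr; exact: cvg_id]. Qed.

Lemma line_map_continuous (a u : X) : continuous (fun t : R => a + t *: u).
Proof. by move=> t; apply: cvgD; [exact: cvg_cst|apply: cvgZl; exact: cvg_id]. Qed.

Lemma affine_open (w : X) (l : R) (U : set X) : l != 0 -> open U ->
  open [set w + l *: u | u in U].
Proof.
move=> l0 oU.
rewrite (_ : _ @` _ = (fun x => - (l^-1 *: w) + l^-1 *: x) @^-1` U).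
  by apply: open_comp => // ? _; exact: affine_continuous.
apply/seteqP; split=> [_ [u Uu <-]|x Ux] /=.
  by rewrite scalerDr scalerA mulVf// scale1r addKr.
exists (- (l^-1 *: w) + l^-1 *: x) => //.
by rewrite scalerDr scalerN !scalerA mulfV// !scale1r addNKr.
Qed.

End AffineMaps.

(** Parametrized lines replace the relative topology and make the notion visibly stable under affine
    substitution; [u = 0] only adds constant functions. *)
Definition line_continuous (R : realType) (X : normedModType R) (f : X -> R) :=
  forall a u : X, continuous (fun t : R => f (a + t *: u)).

Section LineContinuous.
Context {R : realType} {X : normedModType R}.
Implicit Types (f : X -> R).

Lemma linearly_continuous_line f : linearly_continuous f -> line_continuous f.
Proof.
move=> fc a u; have [->|u0] := eqVneq u 0.
  rewrite (_ : (fun t : R => _) = fun=> f a); first by move=> t; exact: cvg_cst.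
  by apply/funext => t; rewrite scaler0 addr0.
move=> t; have Lt s : affine_line a u (a + s *: u) by exists s.
have fct := fc a u u0 (a + t *: u).
have ctn : (fun s : R => a + s *: u) @ t --> (a + t *: u : subspace (affine_line a u)).
  move=> A; rewrite /nbhs/= -(nbhs_subspace_in (Lt t)) => wA.
  apply: (@filterS _ (nbhs t) _
      [set s | affine_line a u (a + s *: u) -> A (a + s *: u)]).
    by move=> s /(_ (Lt s)).
  exact: (@line_map_continuous R X a u t _ wA).
exact: (cvg_comp _ _ ctn fct).
Qed.

Lemma line_continuous_affine f w (l : R) :
  line_continuous f -> line_continuous (fun u => f (w + l *: u)).
Proof.
move=> fc a u; rewrite (_ : (fun t => _) =
    fun t : R => f ((w + l *: a) + t *: (l *: u))).
  exact: fc.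
by apply/funext => t; rewrite scalerDr !scalerA addrA [t * l]mulrC.
Qed.

Lemma continuous_norm_le (g : R -> R) (t q e : R) (A : set R) : continuous g ->
  closure A t -> (forall s, A s -> `|g s - q| <= e) -> `|g t - q| <= e.
Proof.
move=> gc At Ae; rewrite leNgt; apply/negP => et.
have /At[s [/Ae + /=]] : nbhs t [set s | e < `|g s - q|].
  have : (fun s => `|g s - q|) @ t --> `|g t - q|.
    by apply: cvg_norm; apply: cvgB; [exact: gc|exact: cvg_cst].
  by move/cvgr_gt => /(_ e et).
by rewrite leNgt => /negP.
Qed.

Lemma continuous_inv_nat_le (g : R -> R) (q e : R) : continuous g ->
  (forall k, `|g k.+1%:R^-1 - q| <= e) -> `|g 0 - q| <= e.
Proof.
move=> gc gk; apply: (@continuous_norm_le _ _ _ _ (range (@harmonic R))) => //.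
  move=> B /(cvg_harmonic (R := R))[N _ /(_ N (leqnn N)) BN].
  by exists (harmonic N); split=> //; exists N.
by move=> _ [k _ <-]; exact: gk.
Qed.

End LineContinuous.

(* Almost every direction at [y] meets the residual set at all times [1/k]. *)
Lemma line_continuous_residual (R : realType) (X : completeNormedModType R)
    (f : X -> R) (W : set X) (q e : R) : line_continuous f -> open W ->
  meager (W `\` [set x | `|f x - q| <= e]) ->
  forall y, W y -> `|f y - q| <= e.
Proof.
move=> fc oW mW y Wy; set E := [set x | _] in mW.
have [r r0 rW] := open_norm_ball oW Wy.
pose N (k : nat) := (fun u => y + k.+1%:R^-1 *: u) @^-1` (W `\` E).
have mN : meager (\bigcup_k N k).
  apply: meager_bigcup => k; apply: meager_preimage mW; first exact: affine_continuous.
  by move=> U; apply: affine_open.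
have [u [ur Nu]] : exists u, ball (0 : X) r u /\ ~ (\bigcup_k N k) u.
  apply: contrapT => noU; apply: (@open_nonmeager _ X (ball 0 r)).
  - exact: ball_open.
  - by exists 0; exact: ballxx.
  - apply: meagerS mN => u ur; apply: contrapT => nu; apply: noU; exists u.
    by split.
rewrite norm_ballP subr0 in ur.
have := @continuous_inv_nat_le _ (fun t => f (y + t *: u)) q e (fc y u).
rewrite scale0r addr0; apply => k; apply: contrapT => nE; apply: Nu; exists k => //.
split=> //; apply: rW; rewrite addrC addKr normrZ ger0_norm// (le_lt_trans _ ur)//.
by rewrite ler_piMl// invf_le1// ler1n.
Qed.

(** * Step functions on the unit interval *)

Section StepApproximation.
Context {R : realType}.
Implicit Types (F : R -> R).

Lemma continuous_unit_itv_unif F (e : R) : continuous F -> 0 < e ->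
  exists2 N : nat, (0 < N)%N & forall s t : R, 0 <= s <= 1 ->
    `|t - s| <= N%:R^-1 -> `|F t - F s| <= e.
Proof.
move=> Fc e0.
pose P (N : nat) (s : R) := (0 < N)%N /\
  forall t, `|t - s| <= N%:R^-1 -> `|F t - F s| <= e.
have : \forall N \near \oo, `[0, 1] `<=` P N.
  apply: (proj1 (compact_near_coveringP _) (@segment_compact R 0 1)) => x _.
  have e2 : 0 < e / 2 by rewrite divr_gt0.
  have /cvgrPdist_lt/(_ _ e2)/nbhs_ballP[d /= d0 dF] := Fc x.
  (* Half of [d] is spent between [x] and [s], the other half between [s] and [t]. *)
  have [M M0 Md] : exists2 M : nat, (0 < M)%N & M%:R^-1 < d / 2.
    have := near_infty_natSinv_lt (PosNum (divr_gt0 d0 (ltr0n R 2))).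
    by move=> [M _ /(_ M (leqnn M)) ?]; exists M.+1.
  exists (ball x (d / 2), [set n | (M <= n)%N]) => /=.
    split; first by apply: nbhsx_ballx; rewrite divr_gt0.
    by exists M.
  move=> [s N] /= [xs MN]; split; first exact: leq_trans MN.
  move=> t ts.
  have NM : N%:R^-1 <= M%:R^-1 :> R.
    by rewrite lef_pV2 ?posrE ?ltr0n ?(leq_trans M0)// ler_nat.
  have xs' : `|x - s| < d / 2 by [].
  have Fs : `|F x - F s| < e / 2 by apply: dF; rewrite /ball/=; lra.
  have Ft : `|F x - F t| < e / 2.
    apply: dF; rewrite /ball/=; have := ler_distD s x t.
    by rewrite [`|s - t|]distrC; lra.
  by have := ler_distD (F x) (F t) (F s); rewrite [`|F t - F x|]distrC; lra.
move=> [M _ /(_ M (leqnn M)) MP].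
have [M0 _] : P M 0 by apply: MP => /=; rewrite in_itv/= lexx ler01.
exists M => // s t s01 st; have [_] : P M s by apply: MP; rewrite /= in_itv.
exact.
Qed.

(** The values are rational and finitely many, so that the pairs [(N, q)] range over a countable
    type. Uniform continuity costs [e / 2], rounding to a rational the other [e / 2]. *)
Lemma step_approximation F (e : R) : continuous F -> 0 < e ->
  exists (N : nat) (q : seq rat), (0 < N)%N /\
    forall (i : nat) (t : R), 0 < t < 1 -> i%:R < t * N%:R < i.+1%:R ->
      `|F t - ratr q`_i| <= e.
Proof.
move=> Fc e0.
have [N N0 NF] := continuous_unit_itv_unif Fc (divr_gt0 e0 (ltr0n R 2)).
have /choice[c cF] : forall i : nat, exists c : rat,
    `|F (i%:R / N%:R) - ratr c| <= e / 2.
  move=> i; set y := F _.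
  have [c] := @rat_in_itvoo R (y - e / 2) (y + e / 2) ltac:(lra).
  by rewrite in_itv/= => cy; exists c; rewrite ler_norml; apply/andP; split; lra.
exists N, (mkseq c N); split=> // i t t01 it.
have NR : 0 < N%:R :> R by rewrite ltr0n.
have iN : (i < N)%N.
  rewrite -(ltr_nat R) (lt_trans (proj1 (andP it)))//.
  by rewrite gtr_pMl//; case/andP: t01.
have Ft : `|F t - F (i%:R / N%:R)| <= e / 2.
  apply: NF; first by rewrite divr_ge0//= ler_pdivrMr// mul1r ler_nat ltnW.
  have -> : t - i%:R / N%:R = (t * N%:R - i%:R) / N%:R by field; rewrite gt_eqF.
  rewrite normrM normfV [`|N%:R|]gtr0_norm// ler_piMl ?invr_ge0 ?(ltW NR)//.
  by rewrite ler_norml; apply/andP; split; have := natr1 (R := R) i; lra.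
rewrite nth_mkseq//; have := ler_distD (F (i%:R / N%:R)) (F t) (ratr (c i)).
by have := cF i; lra.
Qed.

Lemma rat_near_itv (a b t : R) (B : set R) : a < b -> a <= t <= b -> nbhs t B ->
  exists c : rat, B (ratr c) /\ a < ratr c < b.
Proof.
move=> ab /andP[a_t tb] /nbhs_ballP[r /= r0 rB].
have [|c] := @rat_in_itvoo R (Num.max a (t - r)) (Num.min b (t + r)).
  by rewrite lt_min !gt_max; apply/andP; split; apply/andP; split; lra.
rewrite in_itv/= gt_max lt_min => /andP[/andP[ac tc] /andP[cb ct]].
exists c; split; last by rewrite ac.
by apply: rB; rewrite /ball/= ltr_norml; apply/andP; split; lra.
Qed.

End StepApproximation.

(** * Pencils of lines and their uniform step approximation *)

Section Pencil.
Context {R : realType} {X : normedModType R}.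

(** Being affine in [t] for fixed [u], it makes [f] continuous in [t]; being affine in [u] for fixed
    [t], it transports category. *)
Definition pencil (w0 w1 : X) (l0 l1 t : R) (u : X) : X :=
  (w0 + t *: w1) + (l0 + t * l1) *: u.

Lemma pencil_lineE w0 w1 l0 l1 t u :
  pencil w0 w1 l0 l1 t u = (w0 + l0 *: u) + t *: (w1 + l1 *: u).
Proof. by rewrite /pencil scalerDl scalerDr scalerA addrACA. Qed.

End Pencil.

Section BairePencil.
Context {R : realType} {X : completeNormedModType R} (f : X -> R).
Hypotheses (fc : line_continuous f) (fb : has_baire_property f).
Variables (w0 w1 : X) (l0 l1 : R).
Hypothesis l_neq0 : forall t : R, 0 < t < 1 -> l0 + t * l1 != 0.
Let Phi := pencil w0 w1 l0 l1.

(** At a time where the factor of [u] is nonzero the pencil is continuous and open in [u]. Time 0 is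
    left out because the factor vanishes there at the vertex of a cone. *)
Lemma almost_open_pencil (t q e : R) : 0 < t < 1 ->
  almost_open [set u | `|f (Phi t u) - q| <= e].
Proof.
move=> t01.
have -> : [set u | `|f (Phi t u) - q| <= e] = (Phi t) @^-1` (f @^-1` `[q - e, q + e]).
  by apply/seteqP; split=> u /=; rewrite in_itv/= ler_distl.
apply: almost_open_preimage.
- exact: affine_continuous.
- by move=> U; apply: affine_open; exact: l_neq0.
- by apply: baire_sets_almost_open; apply: fb; exact: measurable_itv.
Qed.

(* The space of continuous functions on [[0, 1]] is separable, so that countably
   many step functions approximate all the [f \o Phi ^~ u]; one of them does so
   for residually many [u] in an open set, hence for all of them. *)
Lemma pencil_step_approximation (e : R) (U : set X) : 0 < e -> open U -> U !=set0 ->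
  exists W, [/\ open W, W !=set0, W `<=` U &
    exists (N : nat) (q : nat -> R), (0 < N)%N /\ forall u, W u ->
      forall (i : nat) (t : R), (i < N)%N -> i%:R <= t * N%:R <= i.+1%:R ->
        `|f (Phi t u) - q i| <= e].
Proof.
move=> e0 oU U0.
have Fc u : continuous (fun t => f (Phi t u)).
  rewrite (_ : (fun t => _) = fun t => f ((w0 + l0 *: u) + t *: (w1 + l1 *: u))).
    exact: fc.
  by apply/funext => t; rewrite -pencil_lineE.
pose D (N i : nat) (c : rat) :=
  0 < (ratr c : R) < 1 /\ i%:R < (ratr c : R) * N%:R < i.+1%:R.
(* Only rational times are tested, so [E] is a countable intersection. The premise makes [E1] the
   whole space when the time is outside the step. *)
pose E1 (p : nat * seq rat) (s : nat * rat) := [set u | D p.1 s.1 s.2 ->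
  `|f (Phi (ratr s.2) u) - ratr p.2`_(s.1)| <= e].
pose E (p : nat * seq rat) := [set u | (0 < p.1)%N] `&` \bigcap_s E1 p s.
have aoE p : almost_open (E p).
  have [p0|p0] := pselect (0 < p.1)%N; last first.
    rewrite (_ : E p = set0); first exact/open_almost_open/open0.
    by rewrite -subset0 => u [/p0].
  rewrite (_ : E p = \bigcap_s E1 p s); last first.
    by rewrite /E; apply/seteqP; split=> [u []|].
  apply: almost_open_bigcap => -[i c].
  have [[c01 cN]|nD] := pselect (D p.1 i c).
    rewrite (_ : E1 p (i, c) = [set u | `|f (Phi (ratr c) u) - ratr p.2`_i| <= e]).
      exact: almost_open_pencil.
    by apply/seteqP; split=> [u|u Eu _ //]; apply.
  rewrite (_ : E1 p (i, c) = setT); first exact/open_almost_open/openT.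
  by apply/seteqP; split=> // u _ /nD.
have [|[N q] [W [oW W0 WU mW]]] := almost_open_cover oU U0 aoE.
  move=> u _; have [N [q [N0 Nq]]] := step_approximation (Fc u) e0.
  by exists (N, q); split=> // -[i c] _ [c01 cN] /=; exact: Nq.
(* Otherwise [E] would be empty and the open set [W] meager. *)
have {}N0 : (0 < N)%N.
  apply: contrapT => N0; apply: (open_nonmeager oW W0); apply: meagerS mW => u Wu.
  by split=> // -[/N0].
exists W; split=> //; exists N, (fun i => ratr q`_i); split=> // u Wu i t iN it.
have NR : 0 < N%:R :> R by rewrite ltr0n.
(* Every time of the closed step, endpoints included, is a limit of rational times of the open
   step. *)
pose A : set R := [set ratr c | c in D N i].
apply: (@continuous_norm_le _ (fun t => f (Phi t u)) t _ _ A) => //.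
  move=> B tB.
  have [||c [Bc /andP[ac cb]]] :=
      @rat_near_itv _ (i%:R / N%:R) (i.+1%:R / N%:R) t B _ _ tB.
  - by rewrite ltr_pM2r ?invr_gt0// ltr_nat.
  - by rewrite ler_pdivrMr// ler_pdivlMr.
  exists (ratr c); split=> //; exists c => //; split.
    rewrite (le_lt_trans _ ac) ?divr_ge0//= (lt_le_trans cb)//.
    by rewrite ler_pdivrMr// mul1r ler_nat.
  by rewrite -ltr_pdivrMr// ac -ltr_pdivlMr.
move=> _ [c Dc <-].
(* At a rational time, linear continuity in [u] extends the bound from residually many [u] to all of
   [W]. *)
apply: (@line_continuous_residual _ X (fun u => f (Phi (ratr c) u)) W) => //.
  exact: line_continuous_affine.
apply: meagerS mW => x [Wx nx]; split=> // -[_ /(_ (i, c) I)/(_ Dc)].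
exact: nx.
Qed.

End BairePencil.

(** * Points of large oscillation *)

Definition oscillation_gt (R : realType) (X : normedModType R) (f : X -> R)
    (e : R) : set X :=
  [set x | forall r : R, 0 < r ->
    exists y z, [/\ `|y - x| < r, `|z - x| < r & e < `|f y - f z|]].

Section Oscillation.
Context {R : realType} {X : normedModType R} (f : X -> R).

Lemma closed_oscillation_gt e : closed (oscillation_gt f e).
Proof.
move=> x xO r r0; have r2 : 0 < r / 2 by rewrite divr_gt0.
have [x' [+ /=]] := xO _ (nbhsx_ballx x _ r2).
move=> /(_ _ r2)[y [z [yx zx yz]]]; rewrite norm_ballP => xx.
exists y, z; split=> //.
- by have := ler_distD x' y x; lra.
- by have := ler_distD x' z x; lra.
Qed.

(** The factor 3 leaves room above the [2 e] lost when two values of [f] are compared through one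
    step of a step function. *)
Lemma discontinuitiesE :
  discontinuities f = \bigcup_(k : nat) oscillation_gt f (3 * k.+1%:R^-1).
Proof.
apply/seteqP; split=> x.
  rewrite /discontinuities/= => nc; apply: contrapT => nO; apply: nc.
  apply/cvgrPdist_lt => e e0.
  have [k ke] : exists k : nat, 3 * k.+1%:R^-1 < e.
    have e3 : 0 < e / 3 by rewrite divr_gt0.
    have [k _ /(_ k (leqnn k)) /= ke] := near_infty_natSinv_lt (PosNum e3).
    by exists k; rewrite mulrC -ltr_pdivlMr.
  have [r [r0 rf]] : exists r : R, 0 < r /\ forall y, `|y - x| < r -> `|f x - f y| < e.
    apply: contrapT => nr; apply: nO; exists k => // r r0; apply: contrapT => nyz.
    apply: nr; exists r; split=> // y yx; rewrite (le_lt_trans _ ke)// leNgt.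
    by apply/negP => fe; apply: nyz; exists x, y; rewrite subrr normr0.
  by apply/nbhs_ballP; exists r => //= y; rewrite norm_ballP => /rf.
move=> [k _ xO]; rewrite /discontinuities/= => /cvgrPdist_lt.
set e := _ * _ in xO.
have e0 : 0 < e / 2 by rewrite divr_gt0// mulr_gt0// invr_gt0.
move=> /(_ _ e0)/nbhs_ballP[r /= r0 rf]; have [y [z [yx zx]]] := xO r r0.
have := rf y; have := rf z; rewrite !norm_ballP => /(_ zx) fz /(_ yx) fy.
by have := ler_distD (f x) (f y) (f z); rewrite [`|f y - f x|]distrC; lra.
Qed.

End Oscillation.

(** * Open families of lines and rays that avoid large oscillation *)

Section Avoidance.
Context {R : realType} {X : completeNormedModType R} (f : X -> R).
Hypotheses (fc : line_continuous f) (fb : has_baire_property f).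
Implicit Types (A U W : set X).

(** At a fixed time [t] the image of [W] is open, and on it [f] stays within [e] of one value
    [q i]. *)
Lemma pencil_avoids_oscillation (w0 w1 : X) (l0 l1 e : R) U :
    (forall t : R, 0 < t < 1 -> l0 + t * l1 != 0) ->
    0 < e -> open U -> U !=set0 ->
  exists W, [/\ open W, W !=set0, W `<=` U &
    forall u t, W u -> 0 < t < 1 ->
      ~ oscillation_gt f (3 * e) (pencil w0 w1 l0 l1 t u)].
Proof.
move=> l_neq0 e0 oU U0.
have [W [oW W0 WU [N [q [N0 Nq]]]]] :=
  pencil_step_approximation fc fb w0 w1 l_neq0 e0 oU U0.
exists W; split=> // u t Wu t01.
have NR : 0 < N%:R :> R by rewrite ltr0n.
have tN0 : 0 <= t * N%:R by case/andP: t01 => t0 _; rewrite mulr_ge0// ltW.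
have /andP[it ti] := truncn_itv tN0; set i := Num.truncn _ in it ti.
have iN : (i < N)%N.
  rewrite -(ltr_nat R) (le_lt_trans it)// gtr_pMl//.
  by case/andP: t01.
have oPW : open (pencil w0 w1 l0 l1 t @` W) by apply: affine_open => //; exact: l_neq0.
have [r r0 rP] := open_norm_ball oPW (ex_intro2 _ _ u Wu erefl).
move=> /(_ r r0)[_ [_ [/rP[y Wy <-] /rP[z Wz <-]]]].
have it' : i%:R <= t * N%:R <= i.+1%:R by rewrite it ltW.
have := Nq y Wy i t iN it'; have := Nq z Wz i t iN it'.
rewrite [`|f (_ z) - _|]distrC => fz fy.
have := ler_distD (q i) (f (pencil w0 w1 l0 l1 t y)) (f (pencil w0 w1 l0 l1 t z)).
by lra.
Qed.

(** As [A] is bounded, nearby lines can meet it only for [|t| < T]; this segment of times is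
    rescaled to the unit interval. *)
Lemma lines_avoid_oscillation A (e M : R) (v : X) U :
    0 < e -> A `<=` oscillation_gt f (3 * e) -> (forall x, A x -> `|x| <= M) ->
    v != 0 -> open U -> U !=set0 ->
  exists W, [/\ open W, W !=set0, W `<=` U &
    forall z (t : R), W z -> ~ A (z + t *: v)].
Proof.
move=> e0 AO AM v0 oU [z0 Uz0].
have nv : 0 < `|v| by rewrite normr_gt0.
(* For [z] within 1 of [z0], [|t| |v| <= |z + t v| + |z| < M + |z0| + 1]. The absolute value of [M]
   keeps [T] positive even when [A] is empty. *)
pose T := (`|z0| + 1 + `|M|) / `|v|.
have T0 : 0 < T by rewrite divr_gt0// ltr_wpDr// ltr_wpDl.
have [||//||W [oW W0 WU WO]] :=
  @pencil_avoids_oscillation (- T *: v) ((2 * T) *: v) 1 0 e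
    (U `&` ball z0 1).
- by move=> t _; rewrite mulr0 addr0 oner_neq0.
- by [].
- by apply: openI => //; exact: ball_open.
- by exists z0; split=> //; exact: ballxx.
exists W; split=> // [z /WU[]//|z t Wz Az].
have tT : `|t| < T.
  rewrite ltr_pdivlMr// -normrZ; have := AM _ Az; have := (WU _ Wz).2.
  rewrite norm_ballP => zz zM; have := ler_distD z0 z 0; rewrite !subr0 => z1.
  have : `|t *: v| <= `|z + t *: v| + `|z|.
    by rewrite -{1}[t *: v](addKr z) addrC (le_trans (ler_normB _ _)).
  by have := ler_norm M; lra.
apply: (WO z ((t + T) / (2 * T)) Wz).
  rewrite ltr_norml in tT.
  by rewrite divr_gt0/= ?ltr_pdivrMr; lra.
apply: AO; rewrite /pencil mulr0 addr0 scale1r addrC.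
rewrite scalerA -scalerDl (_ : - T + _ = t)//.
by field; rewrite gt_eqF.
Qed.

(** As [A] lies in a shell around [c], rays with direction near [u0] can meet it only at times
    between two positive bounds, where the factor of [u] in the pencil stays positive. *)
Lemma rays_avoid_oscillation A (e M d : R) (c u0 : X) U :
    0 < e -> A `<=` oscillation_gt f (3 * e) ->
    0 < d -> (forall x, A x -> d <= `|x - c| <= M) ->
    u0 != 0 -> open U -> U u0 ->
  exists W, [/\ open W, W !=set0, W `<=` U &
    forall u (t : R), W u -> 0 < t -> ~ A (c + t *: u)].
Proof.
move=> e0 AO d0 AM u00 oU Uu0.
have nu : 0 < `|u0| by rewrite normr_gt0.
(* From [|u| < 2 |u0|] one gets [t > a], from [|u0| < 2 |u|] one gets [t <= 2 |M| / |u0| < b]; the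
   summand [a + 1] ensures [a < b]. *)
pose a := d / (2 * `|u0|); pose b := 2 * `|M| / `|u0| + a + 1.
have a0 : 0 < a by rewrite divr_gt0// mulr_gt0.
have ab : a < b.
  have : 0 <= 2 * `|M| / `|u0| by rewrite divr_ge0// mulr_ge0.
  by rewrite /b; lra.
have [||//||W [oW W0 WU WO]] := @pencil_avoids_oscillation c 0 a (b - a) e
    (U `&` ball u0 (`|u0| / 2)).
- move=> t /andP[t0 _]; rewrite gt_eqF//.
  by rewrite addr_gt0// mulr_gt0// subr_gt0.
- by [].
- by apply: openI => //; exact: ball_open.
- by exists u0; split=> //; apply: ballxx; rewrite divr_gt0.
exists W; split=> // [z /WU[]//|u t Wu t0 Au].
have /andP[at_ tb] : a < t < b.
  have := AM _ Au; rewrite addrC addKr normrZ gtr0_norm// => /andP[dt tM].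
  have := (WU _ Wu).2; rewrite norm_ballP => uu.
  have u1 : `|u| < 2 * `|u0| by have := ler_distD u0 u 0; rewrite !subr0; lra.
  have u2 : `|u0| < 2 * `|u| by have := ler_distD u u0 0; rewrite !subr0 distrC; lra.
  apply/andP; split.
    by rewrite ltr_pdivrMr ?mulr_gt0// (le_lt_trans dt)// ltr_pM2l.
  rewrite /b -addrA ltr_pwDr ?addr_gt0// ler_pdivlMr//.
  have := ler_norm M; have : t * `|u0| <= t * (2 * `|u|) by rewrite ler_pM2l// ltW.
  by lra.
have ba : b - a != 0 by rewrite gt_eqF// subr_gt0.
apply: (WO u ((t - a) / (b - a)) Wu).
  by rewrite divr_gt0/= ?ltr_pdivrMr; lra.
by apply: AO; rewrite /pencil scaler0 addr0 divfK// subrKC.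
Qed.

End Avoidance.

(** * Relative nowhere density and Lipschitz graphs *)

Lemma nowhere_dense_inP (T : topologicalType) (S A : set T) : A `<=` S ->
  (forall U, open U -> U `&` S !=set0 ->
    exists W, [/\ open W, W `&` S !=set0, W `<=` U & W `&` A = set0]) ->
  nowhere_dense_in S A.
Proof.
move=> AS H; apply/nowhere_denseP => U /open_subspaceP[V oV VU] [x Ux].
(* A relatively open set may consist of isolated points outside [S]; it then misses [A] already. *)
have [Sx|nS] := pselect (U `&` S !=set0); last first.
  exists U; split=> //; [by apply/open_subspaceP; exists V|by exists x|].
  by rewrite -subset0 => y [Uy Ay]; apply: nS; exists y; split=> //; exact: AS.
have [|W [oW [y [Wy Sy]] WV WA]] := H V oV; first by rewrite VU.
exists (W `&` S); split.
- by apply/open_subspaceP; exists W => //; rewrite -setIA setIid.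
- by exists y.
- by move=> z [Wz Sz]; have [] : (U `&` S) z by rewrite -VU; split=> //; exact: WV.
- by rewrite -subset0 => z [[Wz _] Az]; suff: (W `&` A) z by rewrite WA.
Qed.

Section LipschitzGraphs.
Context {R : realType} {X : normedModType R}.
Implicit Types (B L Y : set X).

(** McShane's formula, the infimum over [b] of [a b + K |z - p b|]. The hypothesis also makes [a] a
    well-defined function of [p x]. *)
Lemma lipschitz_extension B (a : X -> R) (p : X -> X) (K : R) : 0 <= K ->
    (forall x y, B x -> B y -> a x - a y <= K * `|p x - p y|) ->
  exists h : X -> R, (forall x y, `|h x - h y| <= K * `|x - y|) /\
    forall x, B x -> h (p x) = a x.
Proof.
move=> K0 aK; have [[b0 Bb0]|nB] := pselect (B !=set0); last first.
  exists (fun=> 0); split=> [x y|x Bx]; first by rewrite subrr normr0 mulr_ge0.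
  by case: nB; exists x.
pose S z := [set a b + K * `|z - p b| | b in B].
have Slb z : has_lbound (S z).
  exists (a b0 - K * `|p b0 - z|) => _ [b Bb <-].
  have := aK _ _ Bb0 Bb; have := ler_distD z (p b0) (p b).
  by move/(ler_wpM2l K0); rewrite mulrDr; lra.
have infS z b : B b -> inf (S z) <= a b + K * `|z - p b|.
  by move=> Bb; apply: ge_inf; [exact: Slb|exists b].
have Sinf z (m : R) : (forall b, B b -> m <= a b + K * `|z - p b|) -> m <= inf (S z).
  move=> H; apply: lb_le_inf => [|_ [b Bb <-]]; last exact: H.
  by exists (a b0 + K * `|z - p b0|); exists b0.
have half x y : inf (S x) - K * `|x - y| <= inf (S y).
  apply: Sinf => b Bb; have := infS x b Bb; have := ler_distD y x (p b).
  by move/(ler_wpM2l K0); rewrite mulrDr; lra.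
exists (fun z => inf (S z)); split=> [x y|x Bx].
  have := half x y; have := half y x; rewrite [`|y - x|]distrC => xy yx.
  by rewrite ler_norml; apply/andP; split; lra.
apply/eqP; rewrite eq_le; apply/andP; split.
  by have := infS (p x) x Bx; rewrite subrr normr0 mulr0 addr0.
by apply: Sinf => b Bb; have := aK _ _ Bx Bb; lra.
Qed.

Lemma lipschitz_continuous (Z : normedModType R) (h : X -> Z) (K : R) :
  (forall x y, `|h x - h y| <= K * `|x - y|) -> continuous h.
Proof.
move=> hK x; apply/cvgrPdist_lt => e e0.
have K1 : 0 < `|K| + 1 by rewrite ltr_wpDl.
apply/nbhs_ballP; exists (e / (`|K| + 1)) => /=; first by rewrite divr_gt0.
move=> y; rewrite norm_ballP distrC ltr_pdivlMr// => xy.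
apply: le_lt_trans (hK x y) _; apply: le_lt_trans xy.
rewrite mulrC ler_wpM2l//; have := ler_norm K; lra.
Qed.

(* [s] retracts [X] onto [L] along the direction [u]. *)
Lemma cone_free_lipschitz_hypersurface B (u : X) (r : R) : u != 0 -> 0 < r ->
    (forall x y, B x -> B y -> forall t : R, 0 < t -> t * r <= `|y - x - t *: u|) ->
  exists L (s : X -> X), [/\ lipschitz_hypersurface L, B `<=` L,
    continuous s, (forall z, L (s z)) &
    (forall z, L z -> s z = z) /\ (forall z, exists t : R, s z = z + t *: u)].
Proof.
move=> u0 r0 Bcone; have nu : 0 < `|u| by rewrite normr_gt0.
(* Normalised to [g u = 1], so that the kernel of [g] is a closed complement of the line through [u]
   and [p] below projects onto it. *)
have [g0 g0L [g0n g0u]] := norming_functional u.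
pose g x := g0 x / `|u|.
have gL (t : R) x y : g (t *: x + y) = t * g x + g y by rewrite /g g0L mulrDl mulrA.
have g00 : g 0 = 0 by have := gL 1 0 0; rewrite scaler0 addr0; lra.
have gZ (t : R) x : g (t *: x) = t * g x by rewrite -[t *: x]addr0 gL g00 addr0.
have gD x y : g (x + y) = g x + g y by rewrite -[x]scale1r gL mul1r scale1r.
have gB x y : g (x - y) = g x - g y by rewrite gD -scaleN1r gZ mulN1r.
have gu : g u = 1 by rewrite /g g0u divff// gt_eqF.
have gn x : `|g x| <= `|u|^-1 * `|x|.
  by rewrite /g normrM normfV normr_id mulrC ler_wpM2l// invr_ge0.
have gc : continuous (g : X -> R).
  by apply: (@lipschitz_continuous R^o _ (`|u|^-1)) => x y; rewrite -gB.
pose p x := x - g x *: u.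
have gp x : g (p x) = 0 by rewrite gB gZ gu mulr1 subrr.
have pB x y : p x - p y = x - y - g (x - y) *: u.
  by rewrite /p gB scalerBl !opprD !opprK addrACA.
(* The cone condition at [t = g (x - y)] says that the height [g] is Lipschitz over the base point
   [p x], with constant [r^-1]. *)
have [||h [hK hB]] := @lipschitz_extension B g p r^-1.
- by rewrite invr_ge0 ltW.
- move=> x y Bx By; rewrite -gB ler_pdivlMl// mulrC pB.
  have [g_le0|g_gt0] := leP (g (x - y)) 0; last exact: Bcone.
  by rewrite (le_trans _ (normr_ge0 _))// mulr_le0_ge0// ltW.
have pid y : g y = 0 -> p y = y by move=> gy; rewrite /p gy scale0r subr0.
pose s z := p z + h (p z) *: u.
exists [set y + h y *: u | y in [set y | g y = 0]], s; split.
- exists [set t *: u | t in [set: R]], [set y | g y = 0], (fun y => h y *: u); split.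
  + by exists u.
  + split.
    * split=> [|t x y]; rewrite !inE//= => gx gy.
      by rewrite gL gx gy mulr0 addr0.
    * rewrite (_ : [set y | _] = g @^-1` [set 0]) //; apply: closed_comp => [x _|].
        exact: gc.
      exact: closed_eq.
    * split.
        apply/seteqP; split=> [_ [[t _ <-] /=]|_ ->/=].
          by rewrite gZ gu mulr1 => ->; rewrite scale0r.
        by split=> //; exists 0 => //; rewrite scale0r.
      move=> x; exists (g x *: u); first by exists (g x).
      by exists (p x); [exact: gp|rewrite /p addrC subrK].
  + by move=> y _; exists (h y).
  + exists (r^-1 * `|u|); split; first exact: num_real.
    move=> M KM [x y] _ /=; rewrite /self_sub/=.
    rewrite -scalerBl normrZ; apply: le_trans (_ : r^-1 * `|u| * `|x - y| <= _).
      by rewrite -mulrA [`|u| * _]mulrC mulrA ler_wpM2r.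
    by rewrite ler_wpM2r// ltW.
  + by [].
- by move=> x Bx; exists (p x); [exact: gp|rewrite hB// /p subrK].
- apply: (@lipschitz_continuous _ _ (2 + r^-1 * 2 * `|u|)) => x y.
  have pn : `|p x - p y| <= 2 * `|x - y|.
    rewrite pB (le_trans (ler_normB _ _))// normrZ.
    have := ler_wpM2r (ltW nu) (gn (x - y)); rewrite mulrAC mulVf ?gt_eqF// mul1r.
    by lra.
  have -> : s x - s y = (p x - p y) + (h (p x) - h (p y)) *: u.
    by rewrite /s opprD addrACA scalerBl.
  rewrite (le_trans (ler_normD _ _))// normrZ mulrDl lerD// mulrAC ler_wpM2r//.
  by rewrite (le_trans (hK _ _))// -mulrA ler_wpM2l// invr_ge0 ltW//.
- by move=> z; exists (p z) => //; exact: gp.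
- split=> [_ [y /= gy <-]|z].
    by rewrite /s (_ : p (y + h y *: u) = y)// /p gD gZ gy gu add0r mulr1 addrK.
  by exists (h (p z) - g z); rewrite /s /p scalerBl addrA addrAC.
Qed.

End LipschitzGraphs.

(** * The three smallness properties *)

Section SmallSets.
Context {R : realType} {X : completeNormedModType R} (f : X -> R).
Hypotheses (fc : line_continuous f) (fb : has_baire_property f).
Variables (A : set X) (e M : R).
Hypotheses (e0 : 0 < e) (AO : A `<=` oscillation_gt f (3 * e))
  (AM : forall x, A x -> `|x| <= M).

(** The retraction [s] moves points along [u] only, so it sends a line that avoids [A] to a point of
    [L] outside [A]. *)
Lemma nowhere_dense_in_graph (L : set X) (s : X -> X) (u : X) :
    closed A -> A `<=` L -> u != 0 -> continuous s -> (forall z, L (s z)) ->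
    (forall z, L z -> s z = z) -> (forall z, exists t : R, s z = z + t *: u) ->
  nowhere_dense_in L A.
Proof.
move=> cA AL u0 sc sL sid su; apply: nowhere_dense_inP => // U oU [x [Ux Lx]].
have [||W [_ [z Wz] WU WA]] :=
  @lines_avoid_oscillation _ _ _ fc fb A e M u (s @^-1` U) e0 AO AM u0.
- by apply: open_comp => // ? _; exact: sc.
- by exists x; rewrite /= sid.
exists (U `&` ~` A); split.
- by apply: openI => //; exact: closed_openC.
- exists (s z); split => //; split; first exact: WU.
  by have [t ->] := su z; exact: WA.
- by move=> ? [].
- by rewrite -subset0 => ? [[_ +]].
Qed.

Lemma meager_in_projection (H : set X) (p : {linear X -> X}) :
  hyperplane0 H -> linear_projection_onto H p -> meager_in H (p @` A).
Proof.
move=> [Hsub [V [v0 v0n ->] [VH VHD]]] [pH pid].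
have Hv0 : ~ H v0.
  move=> Hv; have : ([set t *: v0 | t in [set: R]] `&` H) v0.
    by split=> //; exists 1 => //; rewrite scale1r.
  by rewrite VH /= => /eqP; rewrite (negbTE v0n).
(* This vector spans the kernel of [p]. *)
pose v := v0 - p v0.
have vn : v != 0 by apply/eqP => /subr0_eq v0p; apply: Hv0; rewrite v0p.
have pv x : exists t : R, x = p x + t *: v.
  have [_ [t _ <-] [h Hh xE]] := VHD x; exists t.
  by rewrite xE linearD linearZ/= (pid _ Hh) /v scalerBr [RHS]addrC addrA subrK.
clearbody v.
apply: nowhere_dense_meager; apply: nowhere_dense_inP; first by move=> _ [x _ <-].
move=> U oU [h [Uh Hh]].
have [dH|ndH] := pselect (dense H).
  have [|W [oW W0 WU WA]] :=
    @lines_avoid_oscillation _ _ _ fc fb A e M v U e0 AO AM vn oU.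
    by exists h.
  exists W; split=> //; first exact: dH.
  rewrite -subset0 => y [Wy [x Ax xy]]; have [t xE] := pv x.
  by apply: (WA y t Wy); rewrite -xy -xE.
have pc : continuous p.
  have [G [[x0 [oG Gx0]] GH0]] := denseNE ndH.
  have [r r0 rG] := open_norm_ball oG Gx0.
  have [s0 x0E] := pv x0.
  apply: bounded_linear_continuous; apply/ex_bound; exists (r + `|s0| * `|v|).
  apply/nbhs_ballP; exists r => //= d; rewrite norm_ballP subr0 => dr.
  (* If [|s| > |s0|], subtracting [(s0 / s) d] from [x0] would cancel its component along [v]
     without leaving [G], although [G] misses [H]. *)
  have [s dE] := pv d; have ss0 : `|s| <= `|s0|.
    rewrite leNgt; apply/negP => s0s.
    have s_neq0 : s != 0 by rewrite -normr_gt0 (le_lt_trans _ s0s).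
    suff : (G `&` H) (x0 - (s0 / s) *: d) by rewrite GH0.
    split.
      apply: rG; rewrite addrC addKr normrN normrZ (le_lt_trans _ dr)// ler_piMl//.
      by rewrite normrM normfV ler_pdivrMr ?normr_gt0// mul1r ltW.
    rewrite [x in H x](_ : _ = p (x0 - (s0 / s) *: d)); first exact: pH.
    have pd : p ((s0 / s) *: d) = (s0 / s) *: p d by rewrite linearZ.
    rewrite linearB pd {1}x0E {1}dE scalerDr scalerA divfK// opprD.
    by rewrite addrACA subrr addr0.
  rewrite /= (_ : p d = d - s *: v); last by rewrite {2}dE addrK.
  by rewrite (le_trans (ler_normB _ _))// lerD ?(ltW dr)// normrZ ler_wpM2r.
have [||W [oW [z Wz] WU WA]] :=
    @lines_avoid_oscillation _ _ _ fc fb A e M v (p @^-1` U) e0 AO AM vn.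
- by apply: open_comp => // ? _; exact: pc.
- by exists h; rewrite /= pid.
have [t zE] := pv z.
exists (U `&` [set y | W (y + t *: v)]); split.
- apply: openI => //; rewrite (_ : [set y | _] = (fun y => t *: v + 1 *: y) @^-1` W).
    by apply: open_comp => // ? _; exact: affine_continuous.
  by apply/seteqP; split=> y /=; rewrite scale1r addrC.
- by exists (p z); split=> //; split; [exact: WU|rewrite /= -zE].
- by move=> ? [].
- rewrite -subset0 => y [[_ /= Wy] [x Ax xy]]; have [r xE] := pv x.
  apply: (WA _ (r - t) Wy); rewrite -addrA -scalerDl subrKC.
  by rewrite -xy -xE.
Qed.

(** The fibres of the radial projection are the open rays from [c], and an open set of directions
    has rays that avoid [A]. *)
Lemma meager_in_radial_projection (c : X) : closed A -> ~ A c ->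
  meager_in (unit_sphere X) (radial_projection c @` A).
Proof.
move=> cA Ac.
have [d d0 dA] := open_norm_ball (closed_openC cA) Ac.
have Ad x : A x -> d <= `|x - c| <= M + `|c|.
  move=> Ax; rewrite (le_trans (ler_normB _ _)) ?lerD ?AM// andbT leNgt.
  by apply/negP => /dA.
have xc x : A x -> 0 < `|x - c| by move=> /Ad /andP[+ _]; exact: lt_le_trans.
apply: nowhere_dense_meager; apply: nowhere_dense_inP.
  move=> _ [x Ax <-]; rewrite /unit_sphere /radial_projection /= normrZ normfV normr_id.
  by rewrite mulVf// gt_eqF// xc.
move=> U oU [u0 [Uu0 /= u01]].
have [V [oV Vu0 Vn]] : exists V : set X, [/\ open V, V u0 &
    forall u, V u -> u != 0 /\ U (`|u|^-1 *: u)].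
  exists [set u | u != 0 /\ U (`|u|^-1 *: u)]; split=> //.
    rewrite openE => u [un Uu]; apply: filterI.
      by apply: open_nbhs_nbhs; split=> //; exact: open_nonzero.
    have : (fun x => `|x|^-1 *: x) @ u --> `|u|^-1 *: u.
      apply: cvgZ; last exact: cvg_id.
      by apply: cvgV; [rewrite normr_eq0|exact: cvg_norm cvg_id].
    by apply; exact: open_nbhs_nbhs (conj oU Uu).
  by rewrite /= -normr_gt0 u01 invr1 scale1r ltr01.
have u0n : u0 != 0 by rewrite -normr_gt0 u01.
have [W [oW [u1 Wu1] WV WA]] :=
  @rays_avoid_oscillation _ _ _ fc fb A e (M + `|c|) d c u0 V e0 AO d0 Ad u0n oV Vu0.
have [u1n Uu1] := Vn _ (WV _ Wu1).
have nu1 : 0 < `|u1| by rewrite normr_gt0.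
(* Directions in [W] need not be unit vectors; scaling by [|u1|] carries the unit vectors near
   [u1 / |u1|] into [W]. *)
exists (U `&` [set y | W (`|u1| *: y)]); split.
- apply: openI => //; rewrite (_ : [set y | _] = (fun y => 0 + `|u1| *: y) @^-1` W).
    by apply: open_comp => // ? _; exact: affine_continuous.
  by apply/seteqP; split=> y /=; rewrite add0r.
- exists (`|u1|^-1 *: u1); split; last first.
    by rewrite /unit_sphere/= normrZ normfV normr_id mulVf// gt_eqF.
  by split=> //=; rewrite scalerA mulfV ?gt_eqF// scale1r.
- by move=> ? [].
- rewrite -subset0 => y [[_ /= Wy] [x Ax xy]].
  apply: (WA _ (`|x - c| / `|u1|) Wy); first by rewrite divr_gt0// xc.
  rewrite scalerA divfK ?gt_eqF// -xy /radial_projection scalerA mulfV ?gt_eqF ?xc//.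
  by rewrite scale1r subrKC.
Qed.

End SmallSets.

(** * Separability and truncated cones *)

Lemma separable_dense_sequence (R : realType) (X : normedModType R) :
  separable X -> exists s : nat -> X, forall U, open U -> U !=set0 -> exists i, U (s i).
Proof.
move=> [S cS dS]; have [S0|[s]] := pfcard_geP cS.
  by have [|x []] := dS setT _ openT; [exists 0|rewrite S0].
exists s => U oU U0; have [x [Ux Sx]] := dS U U0 oU.
by have [i _ ix] := @surj _ _ _ _ s x Sx; exists i; rewrite ix.
Qed.

Section Cones.
Context {R : realType} {X : normedModType R} (f : X -> R).

(** The open cone with vertex 0 generated by the ball of radius [r] about [u], truncated at norm
    [r]. One parameter serves for both radii. *)
Definition cone (u : X) (r : R) : set X :=
  [set d | `|d| < r /\ exists2 t : R, 0 < t & `|d - t *: u| < t * r].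

Lemma cone_near u r d : cone u r d ->
  exists2 a : R, 0 < a & forall d', `|d' - d| < a -> cone u r d'.
Proof.
move=> [dr [t t0 dt]]; exists (Num.min (r - `|d|) (t * r - `|d - t *: u|)).
  by rewrite lt_min !subr_gt0 dr.
move=> d'; rewrite lt_min => /andP[d'd d't]; split.
  by have := ler_distD d d' 0; rewrite !subr0; lra.
by exists t => //; have := ler_distD d d' (t *: u); lra.
Qed.

Definition cone_oscillation_le (u : X) (r e : R) : set X :=
  [set x | forall d d', cone u r d -> cone u r d' -> `|f (x + d) - f (x + d')| <= e].

(** Since the cone is open, [x + d] and [x + d'] also lie in the cones translated to points close to
    [x]. *)
Lemma closed_cone_oscillation_le u r e : closed (cone_oscillation_le u r e).
Proof.
move=> x xS d d' /cone_near[a a0 ad] /cone_near[a' a0' ad'].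
have [|y [yS]] := xS (ball x (Num.min a a')).
  by apply: nbhsx_ballx; rewrite lt_min a0.
rewrite norm_ballP distrC lt_min => /andP[yxa yxa'].
have := yS (x - y + d) (x - y + d') (ad _ _) (ad' _ _).
have yE w : y + (x - y + w) = x + w by rewrite addrA subrKC.
by rewrite !addrK !yE; apply.
Qed.

Lemma cone_oscillation_leP u r e x y : cone_oscillation_le u r e x ->
  cone u r (y - x) -> forall e', e < e' -> ~ oscillation_gt f e' y.
Proof.
move=> xS /cone_near[a a0 ad] e' ee' /(_ _ a0)[z [z' [zy z'y fz]]].
have := xS (z - x) (z' - x) (ad _ _) (ad _ _).
rewrite !subrKC => /(_ _ _) le_e; suff : `|f z - f z'| <= e by lra.
by apply: le_e; rewrite opprB addrA subrK.
Qed.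

End Cones.

(** * The countable decomposition of the set of discontinuities *)

Theorem proposition5p1 (R : realType) (X : completeNormedModType R)
    (sepX : separable X) (dimX : dim_ge2 X)
    (f : X -> R) (fcont : linearly_continuous f)
    (fbaire : has_baire_property f) :
  exists2 B : nat -> set X,
    discontinuities f = \bigcup_k B k &
    forall k : nat,
      [/\ exists L : set X,
            [/\ lipschitz_hypersurface L, B k `<=` L, bounded_set (B k),
                closed (B k) & nowhere_dense_in L (B k)],
          (forall (H : set X) (p : {linear X -> X}),
             hyperplane0 H -> linear_projection_onto H p ->
             meager_in H (p @` B k)) &
          (forall c : X, ~ B k c ->
             meager_in (unit_sphere X) (radial_projection c @` B k))].
Proof.
have fc := linearly_continuous_line fcont.
have [a a0] : exists a : X, a != 0.
  have [x [y xy]] := dimX; exists x; apply/eqP => x0.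
  have [] := xy 1 0; first by rewrite x0 scaler0 scale0r addr0.
  by move/eqP; rewrite oner_eq0.
have [s sdense] := separable_dense_sequence sepX.
pose u i := if s i == 0 then a else s i.
have u0 i : u i != 0 by rewrite /u; case: ifPn.
pose r (n : nat) : R := n.+1%:R^-1.
have r0 n : 0 < r n by rewrite invr_gt0.
(* [k] fixes the oscillation, [n] and [i] the cone, [l] a small ball: two points of a piece differ
   by at most [r n / 2], within the truncation of the cone. *)
pose C (j : nat * nat * nat * nat) := let: (k, n, i, l) := j in
  oscillation_gt f (3 * r k) `&` cone_oscillation_le f (u i) (r n) (2 * r k)
  `&` [set x | `|x - s l| <= r n / 4].
(* Indices that code no quadruple repeat the piece of [(0, 0, 0, 0)], which adds nothing to the
   union. *)
pose B m := C (odflt (0, 0, 0, 0)%N (unpickle m)).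
exists B.
  rewrite discontinuitiesE; apply/seteqP; split=> [x [k _ xO]|x [m _]]; last first.
    by rewrite /B; case: (odflt _ _) => [[[k n] i] l] /= [[xO _] _]; exists k.
  suff [n [i [l Cx]]] : exists n i l, C (k, n, i, l) x.
    by exists (pickle (k, n, i, l)) => //; rewrite /B pickleK.
  have l_neq0 (t : R) : 0 < t < 1 -> 0 + t * 1 != 0.
    by move=> /andP[t0 _]; rewrite add0r mulr1 gt_eqF.
  have [|W [oW W0 WU [N [q [N0 Nq]]]]] :=
    pencil_step_approximation fc fbaire x 0 l_neq0 (r0 k) open_nonzero.
    by exists a.
  have [i Wi] := sdense W oW W0; have si0 : s i != 0 := WU _ Wi.
  have nsi : 0 < `|s i| by rewrite normr_gt0.
  have ui : u i = s i by rewrite /u (negbTE si0).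
  have [b b0 bW] := open_norm_ball oW Wi.
  have NR : 0 < N%:R :> R by rewrite ltr0n.
  (* The bound [b] keeps the ball of radius [r n] about [s i] inside [W]; the other bound makes the
     truncated cone end within the first step, [t <= 1 / N]. *)
  have m0 : 0 < Num.min b (`|s i| / (2 * N%:R)).
    by rewrite lt_min b0 divr_gt0// mulr_gt0.
  have [n _ /(_ n (leqnn n)) /=] := near_infty_natSinv_lt (PosNum m0).
  rewrite -/(r n) lt_min => /andP[rb rs].
  have [||l xl] := sdense (ball x (r n / 4)).
  - exact: ball_open.
  - by exists x; apply: ballxx; rewrite divr_gt0.
  exists n, i, l; split; last by rewrite /= distrC ltW// -norm_ballP.
  split=> // d d' dC d'C.
  have near d1 : cone (u i) (r n) d1 -> `|f (x + d1) - q 0%N| <= r k.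
    move=> [dr [t t0]]; rewrite ui => dt.
    have td : d1 = t *: (t^-1 *: d1) by rewrite scalerA mulfV ?gt_eqF// scale1r.
    have := Nq (t^-1 *: d1) _ 0%N t N0; rewrite /pencil scaler0 addr0 add0r mulr1 -td.
    apply.
      apply: bW; apply: lt_trans rb; rewrite -(ltr_pM2l t0) (le_lt_trans _ dt)//.
      by rewrite -{1}(gtr0_norm t0) -normrZ scalerBr -td.
    (* If [t N > 1], then [2 N t |s i| < 2 N (r n + t r n) < |s i| + t |s i| < 2 N t |s i|], which
       is absurd. *)
    rewrite mulr_ge0 ?(ltW t0)//= leNgt; apply/negP => tN.
    have N1 : 1 <= N%:R :> R by rewrite ler1n.
    have t_si : t * `|s i| < r n + t * r n.
      rewrite -{1}(gtr0_norm t0) -normrZ.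
      by have := ler_distD d1 (t *: s i) 0; rewrite !subr0 [`|_ - d1|]distrC; lra.
    have r_si : r n * (2 * N%:R) < `|s i| by rewrite -ltr_pdivlMr// mulr_gt0.
    have : t * (r n * (2 * N%:R)) < t * `|s i| by rewrite ltr_pM2l.
    have : t * `|s i| * (2 * N%:R) < (r n + t * r n) * (2 * N%:R).
      by rewrite ltr_pM2r// mulr_gt0.
    have : `|s i| < t * N%:R * `|s i| by rewrite ltr_pMl.
    have : t * `|s i| <= t * `|s i| * N%:R by rewrite ler_peMr// mulr_ge0// ltW.
    by lra.
  have := near _ dC; have := near _ d'C; rewrite [`|f (x + d') - _|]distrC.
  by have := ler_distD (q 0%N) (f (x + d)) (f (x + d')); lra.
move=> m; rewrite /B; case: (odflt _ _) => [[[k n] i] l] {B m}; set A := C _.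
have cA : closed A.
  apply: closedI; first by apply: closedI;
    [exact: closed_oscillation_gt|exact: closed_cone_oscillation_le].
  apply: (@closed_comp _ _ (fun x => `|x - s l|) [set y | y <= r n / 4]).
    by move=> x _; apply: cvg_norm; apply: cvgB; [exact: cvg_id|exact: cvg_cst].
  exact: closed_le.
have AO : A `<=` oscillation_gt f (3 * r k) by move=> x [[]].
have AM x : A x -> `|x| <= `|s l| + r n.
  move=> [_ /= xs]; have := ler_distD (s l) x 0; rewrite !subr0.
  by have := r0 n; lra.
have [|L [sg [Llip AL sgc sgL [sgid sgu]]]] :=
  @cone_free_lipschitz_hypersurface _ _ A (u i) (r n) (u0 i) (r0 n).
(* Otherwise [y] would lie in the cone at [x], where [f] oscillates by at most [2 * r k], while [y]
   has oscillation above [3 * r k]. *)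
- move=> x y Ax Ay t t0; rewrite leNgt mulrC -[r n * t]mulrC; apply/negP => xy.
  have yO := AO _ Ay; apply: (cone_oscillation_leP Ax.1.2 _ _ yO).
    split; last by exists t.
    have := Ax.2; have := Ay.2; rewrite /= [`|x - _|]distrC => ys sx.
    by have := ler_distD (s l) y x; have := r0 n; lra.
  by have := r0 k; lra.
split.
- exists L; split=> //.
    exists (`|s l| + r n); split; first exact: num_real.
    by move=> K MK x /AM xM; apply: le_trans xM (ltW MK).
  exact: (@nowhere_dense_in_graph _ _ _ fc fbaire A _ _ (r0 k) AO AM L sg (u i)).
- by move=> H p; apply: (meager_in_projection fc fbaire (r0 k) AO AM).
- by move=> c; apply: (meager_in_radial_projection fc fbaire (r0 k) AO AM cA).
Qed.
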